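(* Let $\varrho>0$, let $\overline u\in L^2(Q)$, and let $u_\varrho\in X$ be the unique solution of \[ \varrho\,\langle S u_\varrho,v\rangle_Q+\langle u_\varrho,v\rangle_{L^2(Q)}=\langle\overline u,v\rangle_{L^2(Q)}\qquad\text{for all } v\in X . \] Then \[ \|u_\varrho-\overline u\|_{L^2(Q)}\le\|\overline u\|_{L^2(Q)} . \] Moreover, if $\overline u\in X$, then \[ \|u_\varrho-\overline u\|_{L^2(Q)}\le\sqrt{\varrho}\,\|\overline u\|_S \qquad\text{and}\qquad \|u_\varrho-\overline u\|_S\le\|\overline u\|_S . \] If in addition $\overline u\in X$ is such that $S\overline u\in L^2(Q)$, then \[ \|u_\varrho-\overline u\|_{L^2(Q)}\le\varrho\,\|S\overline u\|_{L^2(Q)} \qquad\text{and}\qquad \|u_\varrho-\overline u\|_S\le\sqrt{\varrho}\,\|S\overline u\|_{L^2(Q)} . \]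
   Context: Let $\Omega \subset \mathbb{R}^n$, $n=1,2,3$, be a bounded convex domain (with Lipschitz boundary for $n=2,3$), $T>0$, $Q := \Omega\times(0,T)$ and $Q_- := \Omega\times(-T,T)$. Spaces: $H^{1,1}_{0;0,}(Q) := L^2(0,T;H^1_0(\Omega)) \cap H^1_{0,}(0,T;L^2(\Omega))$ is the space of functions with zero lateral boundary values and $u(\cdot,0)=0$; $H^{1,1}_{0;,0}(Q)$ is defined in the same way with the terminal condition $q(\cdot,T)=0$ instead of the initial condition. Both are normed by $(\|\partial_t u\|_{L^2(Q)}^2+\|\nabla_x u\|_{L^2(Q)}^2)^{1/2} = |u|_{H^1(Q)}$; $H^1_0(Q_-)$ is normed by $|\cdot|_{H^1(Q_-)}$. Duals carry the usual dual norms, and $\langle\cdot,\cdot\rangle_Q$, $\langle \cdot,\cdot\rangle_{Q_-}$ denote duality pairings extending the $L^2$ inner products. Wave operator and $X$: with $\Box := \partial_{tt}-\Delta_x$ and, for $u\in L^2(Q)$, $\widetilde u$ the extension of $u$ by zero to $Q_-$, define the distribution $\langle \Box\widetilde u,\varphi\rangle_{Q_-} := \int_Q u\,\Box\varphi\,dx\,dt$ for $\varphi\in C_0^\infty(Q_-)$. Let $\mathcal{H}(Q)$ be the space of all $u \in L^2(Q)$ with $\Box\widetilde u\in [H^1_0(Q_-)]^*$, with norm $(\|u\|_{L^2(Q)}^2+\|\Box\widetilde u\|_{[H^1_0(Q_-)]^*}^2)^{1/2}$. One has $H^{1,1}_{0;0,}(Q)\subset\mathcal{H}(Q)$. Let $X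 := \mathcal{H}_{0;0,}(Q)$ be the closure of $H^{1,1}_{0;0,}(Q)$ in $\mathcal{H}(Q)$, equipped with the equivalent norm $\|u\|_X := \|\Box\widetilde u\|_{[H^1_0(Q_-)]^*}$. Let $Y := H^{1,1}_{0;,0}(Q)$ with $\|q\|_Y := |q|_{H^1(Q)}$. Operators: $A:Y\to Y^*$, $\langle Aw,q\rangle_Q := \langle\partial_t w,\partial_t q\rangle_{L^2(Q)}+\langle\nabla_x w,\nabla_x q\rangle_{L^2(Q)}$ (invertible). $B:X\to Y^*$, $\langle Bv,q\rangle_Q := \langle\Box\widetilde v,\mathcal{E}q\rangle_{Q_-}$, where $\mathcal{E}:H^{1,1}_{0;,0}(Q)\to H^1_0(Q_-)$ is the extension by reflection in time with respect to $t=0$, which satisfies $\|\mathcal{E}q\|_{H^1_0(Q_-)}\le 2\|q\|_{H^{1,1}_{0;,0}(Q)}$. $B^*:Y\to X^*$ is the adjoint of $B$. For $v\in H^{1,1}_{0;0,}(Q)$ and $q \in Y$, $\langle Bv,q\rangle_Q = -\langle\partial_t v,\partial_t q\rangle_{L^2(Q)}+\langle\nabla_x v,\nabla_x q\rangle_{L^2(Q)}$. $S := B^*A^{-1}B:X\to X^*$ is bounded and elliptic on $X$, and $\|u\|_S := \langle Su,u\rangle_Q^{1/2}$ is a norm on $X$ equivalent to $\|\cdot\|_X$. *)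

(* Defs.v *)
From HB Require Import structures.
From mathcomp Require Import all_boot all_order all_algebra.
From mathcomp Require Import all_classical all_reals all_analysis.
Set Implicit Arguments.
Unset Strict Implicit.
Unset Printing Implicit Defensive.
Import Order.TTheory GRing.Theory Num.Theory.
Import numFieldNormedType.Exports.
Local Open Scope classical_set_scope.
Local Open Scope ring_scope.

Definition measure_rV_display : measure_display.
Proof. exact: default_measure_display. Qed.

Section measurable_rV.
Context {R : realType}.
Variable m : nat.

Let coors : 'I_m -> 'rV[R]_m -> measurableTypeR R := fun i x => x ord0 i.

Let rV_set0 : g_sigma_preimage coors set0.
Proof. exact: sigma_algebra0. Qed.

Let rV_setC A : g_sigma_preimage coors A -> g_sigma_preimage coors (~` A).
Proof. exact: sigma_algebraC. Qed.

Let rV_bigcup (F : _^nat) : (forall i, g_sigma_preimage coors (F i)) ->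
  g_sigma_preimage coors (\bigcup_i (F i)).
Proof. exact: sigma_algebra_bigcup. Qed.

HB.instance Definition _ := @isMeasurable.Build measure_rV_display
  'rV[R]_m (g_sigma_preimage coors) rV_set0 rV_setC rV_bigcup.

Lemma measurable_coord (i : 'I_m) :
  measurable_fun [set: 'rV[R]_m] (fun x => x ord0 i : measurableTypeR R).
Proof.
move=> _ Y mY; rewrite setTI; apply: sub_sigma_algebra => /=.
rewrite -bigcup_seq/=; exists i => /=; first by rewrite mem_index_enum.
by exists Y => //; rewrite setTI.
Qed.

Lemma measurable_fun_coord d (T : measurableType d) (f : T -> 'rV[R]_m) :
  (forall i, measurable_fun [set: T] (fun x => f x ord0 i : measurableTypeR R)) ->
  measurable_fun [set: T] f.
Proof.
move=> mf _ A mA; rewrite setTI.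
apply: (mA [set B | measurable (f @^-1` B)]); split.
  split => /=.
  - by rewrite preimage_set0.
  - by move=> B mB; rewrite setTD preimage_setC; exact: measurableC.
  - by move=> F mF; rewrite preimage_bigcup; exact: bigcup_measurable.
move=> B /=; rewrite -bigcup_seq/= => -[i _ [C mC <-]].
by rewrite setTI -[X in measurable X]setTI; exact: mf.
Qed.

End measurable_rV.

Section leb_step.
Context {R : realType} {m : nat}.

Definition cons_rV (p : measurableTypeR R * 'rV[R]_m) : 'rV[R]_m.+1 :=
  row_mx (p.1 : R)%:M p.2 : 'rV[R]_(1 + m).

Definition uncons_rV (z : 'rV[R]_m.+1) : measurableTypeR R * 'rV[R]_m :=
  (z ord0 ord0, rsubmx (z : 'rV[R]_(1 + m))).

Lemma cons_rV0 p : cons_rV p ord0 ord0 = p.1.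
Proof.
rewrite /cons_rV (_ : ord0 = lshift m (ord0 : 'I_1)); last exact/val_inj.
by rewrite (row_mxEl (p.1 : R)%:M) mxE eqxx mulr1n.
Qed.

Lemma cons_rVS p (j : 'I_m) : cons_rV p ord0 (rshift 1 j) = p.2 ord0 j.
Proof. by rewrite /cons_rV (row_mxEr (p.1 : R)%:M). Qed.

Lemma cons_rVK : cancel cons_rV uncons_rV.
Proof.
move=> p; rewrite /uncons_rV cons_rV0 /cons_rV row_mxKr.
by case: p.
Qed.

Lemma measurable_cons_rV : measurable_fun [set: _] cons_rV.
Proof.
apply: measurable_fun_coord => i.
have [j ij|j ij] := splitP (i : 'I_(1 + m)).
  rewrite [X in measurable_fun _ X](_ : _ = fst); first exact: measurable_fst.
  apply/funext => p; rewrite (_ : i = ord0) ?cons_rV0//.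
  by apply/val_inj; rewrite /= ij ord1.
rewrite [X in measurable_fun _ X](_ : _ =
  (fun x : 'rV[R]_m => x ord0 j : measurableTypeR R) \o snd).
  by apply: measurableT_comp; [exact: measurable_coord | exact: measurable_snd].
apply/funext => p; rewrite (_ : i = rshift 1 j) ?cons_rVS//.
exact/val_inj.
Qed.

Lemma measurable_uncons_rV : measurable_fun [set: _] uncons_rV.
Proof.
apply/measurable_fun_pairP; split; first exact: measurable_coord.
apply: measurable_fun_coord => i.
rewrite [X in measurable_fun _ X](_ : _ =
    fun x : 'rV[R]_m.+1 => x ord0 (rshift 1 i : 'I_m.+1) : measurableTypeR R).
  exact: measurable_coord.
by apply/funext => z /=; rewrite mxE.
Qed.

Variable mu : {sigma_finite_measure set 'rV[R]_m -> \bar R}.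

Definition leb_cons : set 'rV[R]_m.+1 -> \bar R :=
  pushforward (@lebesgue_measure R \x mu)%E cons_rV.

Let leb_cons0 : leb_cons set0 = 0%E.
Proof. by rewrite /leb_cons /pushforward preimage_set0 measure0. Qed.

Let leb_cons_ge0 A : (0 <= leb_cons A)%E.
Proof. by rewrite /leb_cons /pushforward measure_ge0. Qed.

Let leb_cons_sigma_additive : semi_sigma_additive leb_cons.
Proof.
move=> F mF tF mUF; rewrite /leb_cons /pushforward preimage_bigcup.
apply: measure_semi_sigma_additive.
- by move=> k; rewrite -[X in measurable X]setTI; exact: measurable_cons_rV.
- apply/trivIsetP => /= i j _ _ ij; rewrite -preimage_setI.
  by move/trivIsetP : tF => /(_ _ _ _ _ ij) ->//; rewrite preimage_set0.
- rewrite -preimage_bigcup -[X in measurable X]setTI.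
  exact: measurable_cons_rV.
Qed.

HB.instance Definition _ := isMeasure.Build _ _ _ leb_cons
  leb_cons0 leb_cons_ge0 leb_cons_sigma_additive.

Let leb_cons_sigma_finite : sigma_finite setT leb_cons.
Proof.
have /sigma_finiteP[F [FT ndF Foo]] := sigma_finiteT (@lebesgue_measure R).
have /sigma_finiteP[G [GT ndG Goo]] := sigma_finiteT mu.
exists (fun k => uncons_rV @^-1` (F k `*` G k)).
  rewrite -preimage_bigcup (_ : \bigcup_k _ = setT) ?preimage_setT//.
  apply/seteqP; split => // -[x y] _.
  have [i _ Fix] : (\bigcup_i F i) x by rewrite -FT.
  have [j _ Gjy] : (\bigcup_j G j) y by rewrite -GT.
  exists (maxn i j) => //; split => /=.
  - by move: x Fix; exact/subsetPset/ndF/leq_maxl.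
  - by move: y Gjy; exact/subsetPset/ndG/leq_maxr.
move=> k; have [mF Fk] := Foo k; have [mG Gk] := Goo k; split.
  rewrite -[X in measurable X]setTI; apply: measurable_uncons_rV => //.
  exact: measurableX.
rewrite /leb_cons /pushforward -comp_preimage.
rewrite (_ : uncons_rV \o cons_rV = id); last first.
  by apply/funext => p; exact: cons_rVK.
rewrite preimage_id product_measure1E//.
by rewrite lte_mul_pinfty// ge0_fin_numE.
Qed.

HB.instance Definition _ :=
  Measure_isSigmaFinite.Build _ _ _ leb_cons leb_cons_sigma_finite.

End leb_step.

(* R^0 is a point; the Lebesgue measure on R^(m+1) = R x R^m is the product
   measure. *)
Fixpoint leb {R : realType} (m : nat) :
    {sigma_finite_measure set 'rV[R]_m -> \bar R} :=
  if m is k.+1 then leb_cons (leb k) else \d_(0 : 'rV[R]_0).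

Section function_spaces.
Context {R : realType} {m : nat}.
Implicit Types (D : set 'rV[R]_m) (f u v d : 'rV[R]_m -> R).

(* L^2(D); elements are functions on the whole space of which only the values
   on D matter, and equality almost everywhere is never quotiented out. *)
Definition L2 D : set ('rV[R]_m -> R) :=
  [set u : 'rV[R]_m -> R | measurable_fun D u /\
           (leb m).-integrable D (fun x => (u x ^+ 2)%:E)].

Definition ip D u v : R := \int[leb m]_(x in D) (u x * v x).

Definition L2norm D u : R := Num.sqrt (ip D u u).

Definition partial (i : 'I_m) f : 'rV[R]_m -> R :=
  fun x => 'D_(delta_mx ord0 i) f x.

Definition smooth f := forall s : seq 'I_m,
  continuous (foldr partial f s) /\
  forall (i : 'I_m) (x : 'rV[R]_m),
    derivable (foldr partial f s) x (delta_mx ord0 i).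

Definition testfun D : set ('rV[R]_m -> R) :=
  [set phi : 'rV[R]_m -> R | smooth phi /\
    exists K : set 'rV[R]_m,
      [/\ compact K, K `<=` D & forall x, ~ K x -> phi x = 0]].

(* d = d_i u in the sense of distributions on D *)
Definition weak_partial D (i : 'I_m) u d :=
  forall phi, testfun D phi -> ip D u (partial i phi) = - ip D d phi.

(* The weak derivative in L^2(D), unique up to null sets when it exists. *)
Definition wpartial D (i : 'I_m) u : 'rV[R]_m -> R :=
  xget (fun=> 0) [set d | L2 D d /\ weak_partial D i u d].

(* phi_k -> u and d_i phi_k -> g_i in L^2(D), that is convergence in H^1(D) to
   the function u with gradient g. *)
Definition H1cvg D (phi : nat -> 'rV[R]_m -> R) u (g : 'I_m -> 'rV[R]_m -> R) :=
  [/\ L2 D u, forall i, L2 D (g i),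
      (fun k => L2norm D (phi k \- u)) @ \oo --> (0 : R) &
      forall i, (fun k => L2norm D (partial i (phi k) \- g i)) @ \oo --> (0 : R)].

(* u is in H^1_0(D), the closure of C_0^oo(D) in H^1(D), with gradient g. *)
Definition H10 D u (g : 'I_m -> 'rV[R]_m -> R) :=
  exists phi, (forall k, testfun D (phi k)) /\ H1cvg D phi u g.

(* |phi|_{H^1(D)} for a smooth function phi. *)
Definition H1norm D f : R :=
  Num.sqrt (\sum_(i < m) L2norm D (partial i f) ^+ 2).

End function_spaces.

(* Convexity makes the boundary of such a domain Lipschitz. *)
Definition convex_domain {R : realType} {n : nat} (Omega : set 'rV[R]_n) :=
  [/\ Omega !=set0, open Omega, bounded_set Omega & convex_set Omega].

Section wave.
Context {R : realType} {n : nat}.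
Variables (Omega : set 'rV[R]_n) (T : R).
Local Notation spacetime := 'rV[R]_(1 + n).
Implicit Types (u v w q phi : spacetime -> R).

(* Space-time points carry the time in coordinate 0. *)
Definition pt (t : R) (x : 'rV[R]_n) : spacetime := row_mx t%:M x.
Definition tm (z : spacetime) : R := z ord0 (lshift n ord0).
Definition sp (z : spacetime) : 'rV[R]_n := rsubmx z.

Local Notation ti := (lshift n ord0 : 'I_(1 + n)).
Local Notation si i := (rshift 1 i : 'I_(1 + n)).

Definition Qcyl : set spacetime := [set z | Omega (sp z) /\ 0 < tm z < T].
Definition Qminus : set spacetime := [set z | Omega (sp z) /\ - T < tm z < T].

(* L^2(0,T; H^1_0(Omega)) *)
Definition L2H10 : set (spacetime -> R) :=
  [set u : spacetime -> R | L2 Qcyl u /\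
    exists g : 'I_n -> spacetime -> R, (forall i, L2 Qcyl (g i)) /\
      {ae (@lebesgue_measure R), forall t, 0 < t < T ->
        H10 Omega (fun x => u (pt t x)) (fun i x => g i (pt t x))}].

(* H^1(0,T; L^2(Omega)) with u(., t0) = 0, the value at t0 being that of the
   representative U of u in C([0,T]; L^2(Omega)). *)
Definition H1L2 (t0 : R) : set (spacetime -> R) :=
  [set u : spacetime -> R | [/\ L2 Qcyl u,
    exists d, L2 Qcyl d /\ weak_partial Qcyl ti u d &
    exists U : R -> 'rV[R]_n -> R,
      [/\ forall t, 0 <= t <= T -> L2 Omega (U t),
          {ae (@lebesgue_measure R), forall t, 0 < t < T ->
            {ae leb n, forall x, Omega x -> U t x = u (pt t x)}},
          forall s, 0 <= s <= T ->
            L2norm Omega (U t \- U s)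
              @[t --> within [set t | 0 <= t <= T] (nbhs s)] --> (0 : R) &
          L2norm Omega (U t0) = 0]]].

(* H^{1,1}_{0;0,}(Q) for t0 = 0 and H^{1,1}_{0;,0}(Q) for t0 = T *)
Definition H11 (t0 : R) : set (spacetime -> R) := L2H10 `&` H1L2 t0.

Definition Yspace := H11 T.

Definition box phi : spacetime -> R := fun z =>
  partial ti (partial ti phi) z - \sum_(i < n) partial (si i) (partial (si i) phi) z.

(* <box (u extended by 0), phi> for phi in C_0^oo(Q_-) *)
Definition box_dist u phi : R := ip Qcyl u (box phi).

(* The norm of box (u extended by 0) in the dual of H^1_0(Q_-), possibly +oo;
   C_0^oo(Q_-) is dense in H^1_0(Q_-). *)
Definition box_norm u : \bar R :=
  ereal_sup [set (`|box_dist u phi|)%:E | phi in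
    [set phi : spacetime -> R | testfun Qminus phi /\ H1norm Qminus phi <= 1]].

Definition Hspace : set (spacetime -> R) :=
  [set u : spacetime -> R | L2 Qcyl u /\ (box_norm u < +oo)%E].

Definition Hnorm u : R :=
  Num.sqrt (L2norm Qcyl u ^+ 2 + fine (box_norm u) ^+ 2).

Definition Xspace : set (spacetime -> R) :=
  [set u : spacetime -> R | Hspace u /\
    forall e : R, 0 < e ->
      exists w, [/\ H11 0 w, Hspace w & Hnorm (w \- u) < e]].

(* <box (v extended by 0), psi> for v in H(Q) and psi in H^1_0(Q_-), by
   continuous extension from C_0^oo(Q_-). *)
Definition box_pairing v (psi : spacetime -> R) : R :=
  xget 0 [set l | exists phi : nat -> spacetime -> R,
    [/\ forall k, testfun Qminus (phi k),
        H1cvg Qminus phi psi (fun i => wpartial Qminus i psi) &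
        (fun k => box_dist v (phi k)) @ \oo --> l]].

(* The slice t = 0 lies outside Q, where q carries no information, not even
   measurability; it is a null set, on which the extension is put to 0. *)
Definition reflect0 q : spacetime -> R :=
  fun z => if tm z == 0 then 0 else q (pt `|tm z| (sp z)).

Definition Aop w q : R :=
  ip Qcyl (wpartial Qcyl ti w) (wpartial Qcyl ti q) +
  \sum_(i < n) ip Qcyl (wpartial Qcyl (si i) w) (wpartial Qcyl (si i) q).

Definition Bop v q : R := box_pairing v (reflect0 q).

(* w = A^{-1} f, for f a functional on Y *)
Definition Ainv_graph (f : (spacetime -> R) -> R) w :=
  Yspace w /\ forall q, Yspace q -> Aop w q = f q.

(* S = B^* A^{-1} B, an operator from X to its dual being given by the form
   S u v = <S u, v>. *)
Definition is_schur (S : (spacetime -> R) -> (spacetime -> R) -> R) :=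
  forall u, Xspace u ->
    exists w, Ainv_graph (Bop u) w /\ forall v, Xspace v -> S u v = Bop v w.

Definition Snorm (S : (spacetime -> R) -> (spacetime -> R) -> R) u : R :=
  Num.sqrt (S u u).

(* u is in X and solves the regularized variational problem with target ub. *)
Definition is_solution (S : (spacetime -> R) -> (spacetime -> R) -> R)
    (rho : R) (ub u : spacetime -> R) :=
  Xspace u /\
  forall v, Xspace v -> rho * S u v + ip Qcyl u v = ip Qcyl ub v.

(* The functional S u is represented by the function g of L^2(Q). *)
Definition S_in_L2 (S : (spacetime -> R) -> (spacetime -> R) -> R) u g :=
  L2 Qcyl g /\ forall v, Xspace v -> S u v = ip Qcyl g v.

End wave.

(* Main.v *)
Require Import Defs.
From mathcomp Require Import all_boot all_order all_algebra.
From mathcomp Require Import all_classical all_reals all_analysis.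
From mathcomp Require Import measurable_realfun ring lra.
Set Implicit Arguments.
Unset Strict Implicit.
Unset Printing Implicit Defensive.
Import Order.TTheory GRing.Theory Num.Theory.
Import numFieldNormedType.Exports.
Local Open Scope classical_set_scope.
Local Open Scope ring_scope.

(** The estimates are energy estimates for a variational problem with a
    symmetric positive semidefinite form. With [w_u = A^-1 B u], the form is
    [S u v = <B v, w_u> = <A w_v, w_u>], and [A] is symmetric and
    positive, whence [schurC] and [schur_ge0].

    Testing the equation with [urho] itself gives
    [rho S(urho, urho) + |urho|^2 = <ub, urho>], hence [|urho|^2 <= <ub, urho>],
    which is the first estimate once [|urho - ub|^2] is expanded. If [ub] is in
    [X], testing with the error [d = urho - ub] gives ([energy_identity])
    [[
      |d|^2 + rho S(d, d) = - rho S(ub, d).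
    ]]
    Young's inequality for the form [S] bounds the right-hand side by
    [rho (S(d, d) + S(ub, ub)) / 2], and, when [S ub] is represented by [g],
    Young's inequality in [L^2] bounds it by [(|d|^2 + rho^2 |g|^2) / 2]. All
    four remaining estimates follow by absorbing the terms in [d].

    What has to be justified is that this algebra is licit: [d] must lie in [X],
    and [S] must be bilinear on [X].

    - [X] is a closure, so that it is stable under differences because the
      space H^{1,1} is ([H11B]) and the norm of H(Q) satisfies the triangle
      inequality ([Hnorm_triangle]).
    - [S] is linear because the pairing defining [B] is ([box_pairingB]). This
      pairing is a limit of [box_dist u] along test functions converging in
      H^1_0(Q_-). For [u] in H(Q) the functional [box_dist u] is bounded for the
      H^1 norm ([box_dist_le]), so that the limit exists and does not depend on
      the sequence ([box_pairing_cvg]); linearity in [u] is inherited by the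
      limit. If no sequence converges to the given function, the pairing is
      zero for every [u].

    All this rests on the integrals being finite: on a bounded domain,
    continuous functions are square integrable ([L2_continuous]), in particular
    test functions and their derivatives. *)

(** * The space L^2 *)

Section L2_space.
Context {R : realType} {m : nat}.
Implicit Types (D : set 'rV[R]_m) (u v w : 'rV[R]_m -> R) (c : R).

Lemma L2_mul_integrable D u v : measurable D -> L2 D u -> L2 D v ->
  (leb m).-integrable D (EFin \o (fun x => u x * v x)).
Proof.
move=> mD [mu iu] [mv iv].
apply: (le_integrable mD _ _ (integrableD mD iu iv)).
  by apply/measurable_EFinP; exact: measurable_funM.
move=> x _ /=; rewrite lee_fin ler_norml ger0_norm ?addr_ge0 ?sqr_ge0//.
by have := sqr_ge0 (u x + v x); have := sqr_ge0 (u x - v x);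
  have := sqr_ge0 (u x); have := sqr_ge0 (v x); rewrite !expr2 => *;
  apply/andP; split; nra.
Qed.

Lemma L2Z D c u : measurable D -> L2 D u -> L2 D (fun x => c * u x).
Proof.
move=> mD [mu iu]; split; first exact: measurable_funM.
apply: (eq_integrable mD _ _ _ (integrableZl mD (c ^+ 2) iu)) => x _.
by rewrite -EFinM exprMn.
Qed.

Lemma L2B D u v : measurable D -> L2 D u -> L2 D v -> L2 D (u \- v).
Proof.
move=> mD u2 v2; have iuv := L2_mul_integrable mD u2 v2.
case: u2 v2 => [mu iu] [mv iv]; split; first exact: measurable_funB.
apply: (eq_integrable mD _ _ _
  (integrableB mD (integrableD mD iu iv) (integrableZl mD 2 iuv))) => x _ /=.
by congr EFin; ring.
Qed.

Lemma ipC D u v : ip D u v = ip D v u.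
Proof. by apply: eq_Rintegral => x _; rewrite mulrC. Qed.

Lemma ipBl D u v w : measurable D -> L2 D u -> L2 D v -> L2 D w ->
  ip D (u \- v) w = ip D u w - ip D v w.
Proof.
move=> mD u2 v2 w2; rewrite /ip -RintegralB//; try exact: L2_mul_integrable.
by apply: eq_Rintegral => x _ /=; rewrite mulrBl.
Qed.

Lemma ipBr D u v w : measurable D -> L2 D u -> L2 D v -> L2 D w ->
  ip D w (u \- v) = ip D w u - ip D w v.
Proof. by move=> *; rewrite ipC ipBl// !(ipC D w). Qed.

Lemma ipZr D c u v : measurable D -> L2 D u -> L2 D v ->
  ip D u (fun x => c * v x) = c * ip D u v.
Proof.
move=> mD u2 v2; rewrite /ip -RintegralZl//; last exact: L2_mul_integrable.
by apply: eq_Rintegral => x _ /=; ring.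
Qed.

Lemma ip_ge0 D u : 0 <= ip D u u.
Proof. by apply: Rintegral_ge0 => x _; rewrite -expr2 sqr_ge0. Qed.

Lemma L2norm_ge0 D u : 0 <= L2norm D u.
Proof. exact: sqrtr_ge0. Qed.

Lemma L2norm_sqr D u : L2norm D u ^+ 2 = ip D u u.
Proof. by rewrite sqr_sqrtr// ip_ge0. Qed.

Lemma ip_subself D u v : measurable D -> L2 D u -> L2 D v ->
  ip D (u \- v) (u \- v) = ip D u u - 2 * ip D u v + ip D v v.
Proof.
move=> mD u2 v2; rewrite ipBl// ?ipBr//; last exact: L2B.
by rewrite (ipC D v u); ring.
Qed.

(** The quadratic [t |-> |u - t v|^2] is nonnegative: evaluate it at its
    minimiser, or let [|t|] be large when [|v| = 0]. *)
Lemma ip_CauchySchwarz D u v : measurable D -> L2 D u -> L2 D v ->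
  `|ip D u v| <= L2norm D u * L2norm D v.
Proof.
move=> mD u2 v2; set a := ip D u u; set b := ip D u v; set c := ip D v v.
have quad_ge0 t : 0 <= a - 2 * t * b + t ^+ 2 * c.
  have tv2 := L2Z t mD v2.
  have := ip_ge0 D (u \- (fun x => t * v x)); rewrite ip_subself//.
  by rewrite !ipZr// (ipC D (fun x => t * v x)) ipZr// -/a -/b -/c; congr (_ <= _); ring.
have a0 : 0 <= a := ip_ge0 _ _.
have bac : b ^+ 2 <= a * c.
  have := ip_ge0 D v; rewrite -/c le_eqVlt => /predU1P[c0|c0].
    have [->|b0] := eqVneq b 0; first by rewrite -c0; lra.
    have := quad_ge0 ((a + 1) / (2 * b)); rewrite -c0.
    by rewrite (_ : a - _ + _ = -1) ?ler0N1//; field.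
  have := quad_ge0 (b / c).
  rewrite (_ : a - _ + _ = (a * c - b ^+ 2) / c); last by field; rewrite gt_eqF.
  by rewrite pmulr_lge0 ?invr_gt0// subr_ge0.
by rewrite -sqrtrM// -sqrtr_sqr ler_wsqrtr.
Qed.

Lemma L2norm_triangle D u v : measurable D -> L2 D u -> L2 D v ->
  L2norm D (u \- v) <= L2norm D u + L2norm D v.
Proof.
move=> mD u2 v2.
rewrite -(@ler_pXn2r _ 2) ?nnegrE ?addr_ge0 ?L2norm_ge0//.
rewrite L2norm_sqr ip_subself// sqrrD !L2norm_sqr.
have := ip_CauchySchwarz mD u2 v2; rewrite ler_norml => /andP[+ _].
by move=> *; lra.
Qed.

End L2_space.

(** * Bounded domains *)

Section bounded_domains.
Context {R : realType}.

Definition cube m (M : R) : set 'rV[R]_m :=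
  [set z | forall i, `|z ord0 i| <= M].

Lemma measurable_cube m M : measurable (@cube m M).
Proof.
rewrite (_ : @cube m M = \bigcap_(i in [set: 'I_m])
    (fun z : 'rV[R]_m => z ord0 i : measurableTypeR R) @^-1` `[- M, M]).
  apply: fin_bigcap_measurable => // i _; rewrite -[X in measurable X]setTI.
  exact: measurable_coord.
apply/seteqP; split => z /= zM i; first by move=> _; rewrite /= in_itv/= -ler_norml.
by have := zM i I; rewrite /= in_itv/= -ler_norml.
Qed.

Lemma leb_cube_lty m M : (leb m (@cube m M) < +oo)%E.
Proof.
elim: m => [|m IH]; first by rewrite /= diracE ltry.
rewrite /= /leb_cons /pushforward.
rewrite (_ : _ @^-1` _ = `[- M, M] `*` @cube m M).
  rewrite product_measure1E//; last exact: measurable_cube.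
  by rewrite lte_mul_pinfty// /= lebesgue_measure_itv/=; case: ifP.
apply/seteqP; split => -[t z] /=.
  move=> zM; split; first by have := zM ord0; rewrite cons_rV0/= in_itv/= -ler_norml.
  by move=> i; have := zM (rshift 1 i); rewrite (cons_rVS (t, z)).
rewrite in_itv/= -ler_norml => -[tM zM] i.
have [j ij|j ij] := splitP (i : 'I_(1 + m)).
  by rewrite (_ : i = ord0) ?cons_rV0//; apply/val_inj; rewrite /= ij ord1.
by rewrite (_ : i = rshift 1 j) ?cons_rVS//; exact/val_inj.
Qed.

Lemma compact_cube m M : compact (@cube m M).
Proof.
have := @rV_compact R m (fun=> `[- M, M]%classic) (fun=> @segment_compact _ _ _).
congr compact; apply/seteqP; split => z /= + i => /(_ i).
  by rewrite in_itv/= -ler_norml.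
by rewrite in_itv/= -ler_norml.
Qed.

(** Every point of an open set lies in an open box with rational corners
    contained in the set, and there are countably many such boxes. *)
Lemma open_measurable_rV m (A : set 'rV[R]_m) : open A -> measurable A.
Proof.
move=> oA.
pose box (ab : 'rV[rat]_m * 'rV[rat]_m) : set 'rV[R]_m :=
  [set z | forall i, ratr (ab.1 ord0 i) < z ord0 i < ratr (ab.2 ord0 i)].
have mbox ab : measurable (box ab).
  rewrite (_ : box ab = \bigcap_(i in [set: 'I_m])
      (fun z : 'rV[R]_m => z ord0 i : measurableTypeR R) @^-1`
      `]ratr (ab.1 ord0 i), ratr (ab.2 ord0 i)[).
    apply: fin_bigcap_measurable => // i _; rewrite -[X in measurable X]setTI.
    exact: measurable_coord.
  apply/seteqP; split => z /= zM i; first by move=> _; rewrite /= in_itv/=.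
  by have := zM i I; rewrite /= in_itv.
rewrite (_ : A = \bigcup_(ab in [set ab | box ab `<=` A]) box ab).
  rewrite bigcup_mkcond; apply: countable_bigcupT_measurable => // ab.
  by case: ifP.
apply/seteqP; split => [x Ax|x [ab /= + abx]]; last exact.
move: oA; rewrite openE => /(_ _ Ax) /nbhs_ballP[e /= e0 xeA].
have lo i : {q | x ord0 i - e < (ratr q : R) < x ord0 i}.
  have /rat_in_itvoo/cid[q] : x ord0 i - e < x ord0 i by rewrite ltrBlDr ltrDl.
  by rewrite in_itv/= => xq; exists q.
have hi i : {q | x ord0 i < (ratr q : R) < x ord0 i + e}.
  have /rat_in_itvoo/cid[q] : x ord0 i < x ord0 i + e by rewrite ltrDl.
  by rewrite in_itv/= => xq; exists q.
exists (\row_i sval (lo i), \row_i sval (hi i)) => /=; last first.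
  move=> i; rewrite !mxE.
  by case: (lo i) => /= a /andP[_ ->]; case: (hi i) => /= b /andP[->].
move=> z zab; apply: xeA; split => // j i; rewrite ord1.
have := zab i; rewrite !mxE.
case: (lo i) => /= a /andP[xa ax]; case: (hi i) => /= b /andP[xb bx] /andP[az zb].
by rewrite /ball/= ltr_distl; apply/andP; split; lra.
Qed.

Lemma continuous_measurable_rV m (f : 'rV[R]_m -> R) :
  continuous f -> measurable_fun setT (f : _ -> measurableTypeR R).
Proof.
move=> /continuousP cf; apply: (measurability _ (RGenOpens.measurableE R)).
move=> _ [_ [a [b ->] <-]]; rewrite setTI.
by apply: open_measurable_rV; apply: cf; exact: interval_open.
Qed.

Definition bounded_domain m (D : set 'rV[R]_m) :=
  measurable D /\ exists M, D `<=` cube M.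

Lemma open_bounded_domain m (D : set 'rV[R]_m) :
  open D -> bounded_set D -> bounded_domain D.
Proof.
move=> oD /pinfty_ex_gt0[M _ DM]; split; first exact: open_measurable_rV.
exists M => z /DM zM i; apply: le_trans zM.
have /mapP[j _ ->] : `|z ord0 i| \in [seq `|z x.1 x.2| | x : 'I_1 * 'I_m].
  by apply/mapP; exists (ord0, i) => //=; rewrite mem_enum.
by rewrite [leRHS]/Num.norm /= mx_normrE; apply/bigmax_geP; right => /=; exists j.
Qed.

(** On a bounded set a continuous function is bounded, as the closed cubes are
    compact, and such a set has finite measure. *)
Lemma L2_continuous m (D : set 'rV[R]_m) f :
  bounded_domain D -> continuous f -> L2 D f.
Proof.
move=> [mD [M DM]] cf.
have mf : measurable_fun D f.
  by apply: (measurable_funS measurableT) => //; exact: continuous_measurable_rV.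
split => //; apply: measurable_bounded_integrable => //.
- apply: le_lt_trans (leb_cube_lty m M).
  by apply: le_measure => //; rewrite inE//; exact: measurable_cube.
- exact: measurable_funX.
have /compact_bounded/pinfty_ex_gt0[N N0 fN] :
    compact ((fun z => f z ^+ 2) @` cube M).
  apply: continuous_compact; last exact: compact_cube.
  by apply: continuous_subspaceT => z; apply: (@continuousM _ _ f f); exact: cf.
exists N; split; first exact: num_real.
move=> K /ltW NK z Dz; apply: le_trans NK; apply: fN; exists z => //.
exact: DM.
Qed.

End bounded_domains.

(** * Test functions and convergence in H^1 *)

Lemma subfACA (aT : Type) (V : zmodType) (a b c d : aT -> V) :
  (a \- b) \- (c \- d) = (a \- c) \- (b \- d).
Proof. by apply/funext => x /=; rewrite !opprD addrACA. Qed.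

Section test_functions.
Context {R : realType} {m : nat}.
Implicit Types (D : set 'rV[R]_m) (phi psi u v : 'rV[R]_m -> R).

Lemma smooth_foldrB phi psi s : smooth phi -> smooth psi ->
  foldr partial (phi \- psi) s = foldr partial phi s \- foldr partial psi s.
Proof.
move=> sphi spsi; elim: s => //= i s ->; apply/funext => x.
by apply: deriveB; [have [_] := sphi s|have [_] := spsi s]; exact.
Qed.

Lemma smooth_foldrZ c phi s : smooth phi ->
  foldr partial (fun x => c * phi x) s = fun x => c * foldr partial phi s x.
Proof.
move=> sphi; elim: s => //= i s ->; apply/funext => x.
by apply: deriveZ; have [_] := sphi s; exact.
Qed.

Lemma smoothB phi psi : smooth phi -> smooth psi -> smooth (phi \- psi).
Proof.
move=> sphi spsi s; rewrite smooth_foldrB//; have [cphi dphi] := sphi s.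
have [cpsi dpsi] := spsi s; split; last by move=> i x; exact: derivableB.
by move=> x; apply: continuousB; [exact: cphi|exact: cpsi].
Qed.

Lemma smoothZ c phi : smooth phi -> smooth (fun x => c * phi x).
Proof.
move=> sphi s; rewrite smooth_foldrZ//; have [cphi dphi] := sphi s.
split; last by move=> i x; exact: derivableZ.
by move=> x; apply: continuousM; [exact: cst_continuous|exact: cphi].
Qed.

Lemma foldr_partial0 s : foldr partial (fun _ : 'rV[R]_m => 0 : R) s = fun=> 0.
Proof.
by elim: s => //= i s ->; apply/funext => x; exact: derive_cst.
Qed.

Lemma testfun0 D : testfun D (fun=> 0).
Proof.
split; last by exists set0; split => //; exact: compact0.
move=> s; rewrite foldr_partial0; split; first exact: cst_continuous.
by move=> i x; exact: derivable_cst.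
Qed.

Lemma testfunB D phi psi : testfun D phi -> testfun D psi ->
  testfun D (phi \- psi).
Proof.
move=> [sphi [K [cK KD Kphi]]] [spsi [L [cL LD Lpsi]]].
split; first exact: smoothB.
exists (K `|` L); split; [exact: compactU|by rewrite subUset|].
by move=> x /not_orP[Kx Lx]; rewrite /= Kphi// Lpsi// subr0.
Qed.

Lemma testfunZ D c phi : testfun D phi -> testfun D (fun x => c * phi x).
Proof.
move=> [sphi [K [cK KD Kphi]]]; split; first exact: smoothZ.
by exists K; split => // x Kx; rewrite Kphi// mulr0.
Qed.

Lemma partialB i phi psi : smooth phi -> smooth psi ->
  partial i (phi \- psi) = partial i phi \- partial i psi.
Proof. exact: (@smooth_foldrB _ _ [:: i]). Qed.

Lemma partialZ c i phi : smooth phi ->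
  partial i (fun x => c * phi x) = fun x => c * partial i phi x.
Proof. exact: (@smooth_foldrZ _ _ [:: i]). Qed.

Lemma L2_smooth D phi s : bounded_domain D -> smooth phi ->
  L2 D (foldr partial phi s).
Proof. by move=> bD /(_ s)[cphi _]; exact: L2_continuous. Qed.

Lemma L2_testfun D phi : bounded_domain D -> testfun D phi -> L2 D phi.
Proof. by move=> bD [+ _]; exact: (@L2_smooth _ _ [::]). Qed.

Lemma L2_partial D i phi : bounded_domain D -> smooth phi ->
  L2 D (partial i phi).
Proof. exact: (@L2_smooth _ _ [:: i]). Qed.

Lemma L2norm_cvg0B D (I : Type) (F : set_system I) {FF : Filter F}
    (a b : I -> 'rV[R]_m -> R) : measurable D ->
  (\forall i \near F, L2 D (a i)) -> (\forall i \near F, L2 D (b i)) ->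
  L2norm D (a i) @[i --> F] --> 0 -> L2norm D (b i) @[i --> F] --> 0 ->
  L2norm D (a i \- b i) @[i --> F] --> 0.
Proof.
move=> mD a2 b2 a0 b0.
apply: (@squeeze_cvgr _ _ _ _ (cst 0) (fun i => L2norm D (a i) + L2norm D (b i))).
- apply: filterS2 a2 b2 => i ai bi.
  by rewrite L2norm_ge0 L2norm_triangle.
- exact: cvg_cst.
- by rewrite -[X in _ --> X]addr0; exact: cvgD.
Qed.

Lemma H10B D u v g h : bounded_domain D -> H10 D u g -> H10 D v h ->
  H10 D (u \- v) (fun i => g i \- h i).
Proof.
move=> bD [phi [tphi [u2 g2 phiu phig]]] [psi [tpsi [v2 h2 psiv psih]]].
have mD := bD.1.
exists (fun k => phi k \- psi k); split; first by move=> k; exact: testfunB.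
split; [exact: L2B|by move=> i; exact: L2B| |move=> i].
  under eq_fun do rewrite subfACA.
  apply: L2norm_cvg0B => //; apply: nearW => k; apply: L2B => //;
    exact: L2_testfun.
under eq_fun => k do rewrite (partialB _ (tphi k).1 (tpsi k).1) subfACA.
apply: L2norm_cvg0B => //; apply: nearW => k; apply: L2B => //;
  apply: L2_partial => //; [exact: (tphi k).1|exact: (tpsi k).1].
Qed.

Lemma weak_partialB D i u v d e : bounded_domain D ->
  L2 D u -> L2 D v -> L2 D d -> L2 D e ->
  weak_partial D i u d -> weak_partial D i v e ->
  weak_partial D i (u \- v) (d \- e).
Proof.
move=> bD u2 v2 d2 e2 ud ve phi tphi; have mD := bD.1.
have phi2 := L2_testfun bD tphi; have dphi2 := L2_partial i bD tphi.1.
by rewrite !ipBl// ud// ve//; ring.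
Qed.

Lemma H1norm_ge0 D phi : 0 <= H1norm D phi.
Proof. exact: sqrtr_ge0. Qed.

Lemma H1normZ D c phi : bounded_domain D -> smooth phi ->
  H1norm D (fun x => c * phi x) = `|c| * H1norm D phi.
Proof.
move=> bD sphi; rewrite -sqrtr_sqr -sqrtrM ?sqr_ge0//; congr Num.sqrt.
rewrite mulr_sumr; apply: eq_bigr => i _; rewrite (partialZ c i sphi).
rewrite (L2norm_sqr D (partial i phi)) (L2norm_sqr D (fun x => _)).
have p2 := L2_partial i bD sphi; have mD := bD.1.
by rewrite ipZr//; [rewrite ipC ipZr//; ring|exact: L2Z].
Qed.

(** Two sequences with the same limit in H^1 have the same gradients in the
    limit, and [H1norm] sees only the gradients. With [psi = phi] this says
    that a convergent sequence is a Cauchy sequence. *)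
Lemma H1cvg_close D (phi psi : nat -> _) u g : bounded_domain D ->
  (forall k, testfun D (phi k)) -> H1cvg D phi u g ->
  (forall k, testfun D (psi k)) -> H1cvg D psi u g ->
  forall e, 0 < e -> exists N, forall k l, (N <= k)%N -> (N <= l)%N ->
    H1norm D (phi k \- psi l) <= e.
Proof.
move=> bD tphi [_ g2 _ phig] tpsi [_ _ _ psig] e e0; have mD := bD.1.
have e20 : 0 < e / 2 by rewrite divr_gt0.
have grad_small (chi : nat -> 'rV[R]_m -> R) :
    (forall i, L2norm D (partial i (chi k) \- g i) @[k --> \oo] --> 0) ->
    exists N, forall k, (N <= k)%N ->
      \sum_(i < m) L2norm D (partial i (chi k) \- g i) <= e / 2.
  move=> chig; have sum_cvg0 :
      (\sum_(i < m) L2norm D (partial i (chi k) \- g i)) @[k --> \oo] --> (0 : R).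
    elim: (index_enum 'I_m) => [|i r IH].
      by under eq_fun do rewrite big_nil; exact: cvg_cst.
    under eq_fun do rewrite big_cons.
    by have {}IH := cvgD (chig i) IH; rewrite addr0 in IH; exact: IH.
  have /cvgrPdist_le/(_ _ e20)[N _ chiN] := sum_cvg0; exists N => k /chiN.
  rewrite /= sub0r normrN ger0_norm//.
  by apply: sumr_ge0 => i _; exact: L2norm_ge0.
have [N phiN] := grad_small _ phig; have [M psiM] := grad_small _ psig.
exists (maxn N M) => k l; rewrite !geq_max => /andP[Nk _] /andP[_ Ml].
have pB i : L2norm D (partial i (phi k \- psi l)) <=
    L2norm D (partial i (phi k) \- g i) + L2norm D (partial i (psi l) \- g i).
  rewrite (partialB _ (tphi k).1 (tpsi l).1).
  rewrite (_ : _ \- _ = (partial i (phi k) \- g i) \- (partial i (psi l) \- g i)).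
    by apply: L2norm_triangle => //; apply: L2B => //; apply: L2_partial => //;
      [exact: (tphi k).1|exact: (tpsi l).1].
  by apply/funext => x /=; ring.
(* The Euclidean norm is at most the l^1 norm. *)
have sq_sum (b : 'I_m -> R) : (forall i, 0 <= b i) ->
    \sum_(i < m) b i ^+ 2 <= (\sum_(i < m) b i) ^+ 2.
  move=> b0; rewrite [leRHS]expr2 mulr_suml ler_sum// => i _.
  rewrite expr2 ler_wpM2l// (bigD1 i)//= lerDl.
  by apply: sumr_ge0 => j _; exact: b0.
rewrite -(@ler_pXn2r _ 2) ?nnegrE ?H1norm_ge0 ?(ltW e0)//.
rewrite sqr_sqrtr; last by apply: sumr_ge0 => i _; exact: sqr_ge0.
have nB0 i : 0 <= L2norm D (partial i (phi k \- psi l)) by exact: L2norm_ge0.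
apply: (le_trans (sq_sum _ nB0)).
rewrite ler_pXn2r ?nnegrE ?(ltW e0) ?sumr_ge0//.
apply: (le_trans (ler_sum _ (fun i _ => pB i))); rewrite big_split/=.
by rewrite [leRHS]splitr; apply: lerD; [exact: phiN|exact: psiM].
Qed.

End test_functions.

(** * The spaces H(Q) and X, and the wave operator *)

(** The triangle inequality in the Euclidean plane, which combines those of the
    two parts of the norm of H(Q). *)
Lemma euclid_triangle (R : realType) (a b c x y z : R) :
  0 <= a -> 0 <= b -> 0 <= c -> 0 <= x -> 0 <= y -> 0 <= z ->
  c <= a + b -> z <= x + y ->
  Num.sqrt (c ^+ 2 + z ^+ 2) <=
  Num.sqrt (a ^+ 2 + x ^+ 2) + Num.sqrt (b ^+ 2 + y ^+ 2).
Proof.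
move=> a0 b0 c0 x0 y0 z0 cab zxy.
have s0 (s t : R) : 0 <= s ^+ 2 + t ^+ 2 by rewrite addr_ge0 ?sqr_ge0.
have cs : a * b + x * y <= Num.sqrt (a ^+ 2 + x ^+ 2) * Num.sqrt (b ^+ 2 + y ^+ 2).
  rewrite -sqrtrM// -[leLHS]ger0_norm ?addr_ge0 ?mulr_ge0// -sqrtr_sqr.
  apply: ler_wsqrtr; rewrite -subr_ge0.
  by rewrite (_ : _ - _ = (a * y - b * x) ^+ 2) ?sqr_ge0//; ring.
have c2 : c ^+ 2 <= (a + b) ^+ 2 by rewrite ler_pXn2r// nnegrE addr_ge0.
have z2 : z ^+ 2 <= (x + y) ^+ 2 by rewrite ler_pXn2r// nnegrE addr_ge0.
rewrite -(@ler_pXn2r _ 2) ?nnegrE ?addr_ge0 ?sqrtr_ge0//.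
rewrite sqr_sqrtr// [leRHS]sqrrD !sqr_sqrtr//.
move: cs c2 z2; rewrite !sqrrD; set p := Num.sqrt _ * _ => cs c2 z2; lra.
Qed.

Section wave_spaces.
Context {R : realType} {n : nat} {Omega : set 'rV[R]_n} {T : R}.
Hypotheses (bOmega : bounded_domain Omega) (T0 : 0 < T).
Implicit Types (u v w q phi psi : 'rV[R]_(1 + n) -> R).
Local Notation Q := (Qcyl Omega T).
Local Notation Qm := (Qminus Omega T).

Lemma cylinder_bounded_domain (a b : R) :
  bounded_domain [set z : 'rV[R]_(1 + n) | Omega (sp z) /\ a < tm z < b].
Proof.
have [mO [M OM]] := bOmega; split.
  rewrite (_ : [set z | _] = @sp R n @^-1` Omega `&`
      (fun z : 'rV[R]_(1 + n) => tm z : measurableTypeR R) @^-1` `]a, b[).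
    apply: measurableI; rewrite -[X in measurable X]setTI.
      apply: measurable_fun_coord => // i.
      rewrite [X in measurable_fun _ X](_ : _ =
        fun z : 'rV[R]_(1 + n) => z ord0 (rshift 1 i) : measurableTypeR R).
        exact: measurable_coord.
      by apply/funext => z; rewrite mxE.
    by apply: (measurable_coord (lshift n ord0)) => //; exact: measurable_itv.
  by apply/seteqP; split => z /= [Oz]; rewrite in_itv.
exists (Num.max M (Num.max `|a| `|b|)) => z /= [/OM zM /andP[az zb]] i.
have [j ij|j ij] := splitP i.
  rewrite (_ : i = lshift n ord0); last first.
    by apply/val_inj; rewrite /= ij ord1.
  rewrite -/(tm z) !le_max; apply/orP; right.
  have [t0|t0] := leP 0 (tm z).
    by apply/orP; right; rewrite (ger0_norm t0) (le_trans (ltW zb))// ler_norm.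
  apply/orP; left; rewrite (ltr0_norm t0) -normrN (le_trans _ (ler_norm _))//.
  by rewrite lerN2 ltW.
rewrite (_ : i = rshift 1 j); last exact/val_inj.
by rewrite le_max; apply/orP; left; have := zM j; rewrite mxE.
Qed.

Let bQ : bounded_domain Q := cylinder_bounded_domain 0 T.
Let bQm : bounded_domain Qm := cylinder_bounded_domain (- T) T.
Let mQ : measurable Q := bQ.1.

(** The [L^2]-continuous representative of [u - v] is the difference of those of
    [u] and [v]. *)
Lemma H11B t0 u v : 0 <= t0 <= T ->
  H11 Omega T t0 u -> H11 Omega T t0 v -> H11 Omega T t0 (u \- v).
Proof.
move=> t0T [[u2 [g [g2 ug]]] [_ [d [d2 ud]] [U [U2 Uu Uc U0]]]].
move=> [[v2 [h [h2 vh]]] [_ [e [e2 ve]] [V [V2 Vv Vc V0]]]].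
have mO := bOmega.1.
split.
  split; first exact: L2B.
  exists (fun i => g i \- h i); split; first by move=> i; exact: L2B.
  apply: (@filterS2 _ _ (ae_filter_ringOfSetsType _)) ug vh => t + + tT => /(_ tT) ug /(_ tT) vh.
  exact: H10B ug vh.
split; first exact: L2B.
  by exists (d \- e); split; [exact: L2B|exact: weak_partialB].
exists (fun t => U t \- V t); split.
- by move=> t tT; apply: L2B => //; [exact: U2|exact: V2].
- apply: (@filterS2 _ _ (ae_filter_ringOfSetsType _)) Uu Vv => t + + tT => /(_ tT) Uu /(_ tT) Vv.
  by apply: (@filterS2 _ _ (ae_filter_ringOfSetsType _)) Uu Vv => x + + Ox => /(_ Ox) /= -> /(_ Ox) ->.
- move=> s sT.
  have -> : (fun t => L2norm Omega ((U t \- V t) \- (U s \- V s))) =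
      fun t => L2norm Omega ((U t \- U s) \- (V t \- V s)).
    by apply/funext => t; rewrite subfACA.
  apply: L2norm_cvg0B => //; [| |exact: Uc|exact: Vc].
    rewrite near_withinE; apply: nearW => t tT.
    by apply: L2B => //; exact: U2.
  rewrite near_withinE; apply: nearW => t tT.
  by apply: L2B => //; exact: V2.
- apply/eqP; rewrite eq_le L2norm_ge0 andbT -[leRHS]addr0 -{1}U0 -V0.
  by apply: L2norm_triangle => //; [exact: U2|exact: V2].
Qed.

Lemma continuous_box phi : smooth phi -> continuous (box phi).
Proof.
move=> sphi; have csum r : continuous (fun z : 'rV[R]_(1 + n) =>
    \sum_(i <- r) partial (rshift 1 i) (partial (rshift 1 i) phi) z).
  elim: r => [|i r IH].
    rewrite (_ : (fun z => _) = cst 0); first exact: cst_continuous.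
    by apply/funext => z; rewrite big_nil.
  rewrite (_ : (fun z => _) = partial (rshift 1 i) (partial (rshift 1 i) phi) +
    (fun z => \sum_(j <- r) partial (rshift 1 j) (partial (rshift 1 j) phi) z)).
    have [c _] := sphi [:: rshift 1 i; rshift 1 i].
    by move=> z; apply: continuousD; [exact: c|exact: IH].
  by apply/funext => z; rewrite big_cons.
move=> z; apply: continuousB; last exact: csum.
by have [c _] := sphi [:: lshift n ord0; lshift n ord0]; exact: c.
Qed.

Lemma L2_box phi : smooth phi -> L2 Q (box phi).
Proof. by move=> sphi; apply: L2_continuous => //; exact: continuous_box. Qed.

Lemma boxB phi psi : smooth phi -> smooth psi ->
  box (phi \- psi) = box phi \- box psi.
Proof.
move=> sphi spsi; apply/funext => z.
have pp i : partial i (partial i (phi \- psi)) z =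
    partial i (partial i phi) z - partial i (partial i psi) z.
  by have /= -> := smooth_foldrB [:: i; i] sphi spsi.
have sumE : \sum_(i < n) partial (rshift 1 i) (partial (rshift 1 i) (phi \- psi)) z =
    \sum_(i < n) partial (rshift 1 i) (partial (rshift 1 i) phi) z -
    \sum_(i < n) partial (rshift 1 i) (partial (rshift 1 i) psi) z.
  by rewrite -sumrB; apply: eq_bigr => i _; exact: pp.
transitivity (partial (lshift n ord0) (partial (lshift n ord0) phi) z -
    partial (lshift n ord0) (partial (lshift n ord0) psi) z -
    (\sum_(i < n) partial (rshift 1 i) (partial (rshift 1 i) phi) z -
     \sum_(i < n) partial (rshift 1 i) (partial (rshift 1 i) psi) z)).
  by congr (_ - _); [exact: pp|exact: sumE].
have swap (a b c d : R) : (a - b) - (c - d) = (a - c) - (b - d) by ring.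
exact: swap.
Qed.

Lemma boxZ c phi : smooth phi ->
  box (fun x => c * phi x) = fun x => c * box phi x.
Proof.
move=> sphi; apply/funext => z.
have pp i : partial i (partial i (fun x => c * phi x)) z =
    c * partial i (partial i phi) z.
  by have /= -> := smooth_foldrZ c [:: i; i] sphi.
have sumE : \sum_(i < n) partial (rshift 1 i)
      (partial (rshift 1 i) (fun x => c * phi x)) z =
    c * \sum_(i < n) partial (rshift 1 i) (partial (rshift 1 i) phi) z.
  by rewrite mulr_sumr; apply: eq_bigr => i _; exact: pp.
by rewrite [RHS]mulrBr; congr (_ - _); [exact: pp|exact: sumE].
Qed.

Lemma box_distBl u v phi : L2 Q u -> L2 Q v -> smooth phi ->
  box_dist Omega T (u \- v) phi = box_dist Omega T u phi - box_dist Omega T v phi.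
Proof. by move=> u2 v2 /L2_box phi2; exact: ipBl. Qed.

Lemma box_distBr u phi psi : L2 Q u -> smooth phi -> smooth psi ->
  box_dist Omega T u (phi \- psi) = box_dist Omega T u phi - box_dist Omega T u psi.
Proof.
by move=> u2 sphi spsi; rewrite /box_dist boxB//; apply: ipBr => //; exact: L2_box.
Qed.

Lemma box_distZr u c phi : L2 Q u -> smooth phi ->
  box_dist Omega T u (fun x => c * phi x) = c * box_dist Omega T u phi.
Proof.
by move=> u2 sphi; rewrite /box_dist boxZ//; apply: ipZr => //; exact: L2_box.
Qed.

Lemma H1norm0 : H1norm Qm (fun=> 0) = 0.
Proof.
have s0 : smooth (fun _ : 'rV[R]_(1 + n) => 0 : R) := (testfun0 Qm).1.
transitivity (H1norm Qm (fun x => 0 * (fun _ : 'rV[R]_(1 + n) => 0 : R) x)).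
  by congr H1norm; apply/funext => x; rewrite mul0r.
by rewrite (H1normZ 0 bQm s0) normr0 mul0r.
Qed.

Lemma box_norm_ge0 u : (0 <= box_norm Omega T u)%E.
Proof.
apply: (@le_trans _ _ (`|box_dist Omega T u (fun=> 0)|)%:E).
  by rewrite lee_fin.
apply: ereal_sup_ubound; exists (fun=> 0) => //.
by split; [exact: testfun0|rewrite H1norm0].
Qed.

Lemma box_normB u v : L2 Q u -> L2 Q v ->
  (box_norm Omega T (u \- v)%R <= box_norm Omega T u + box_norm Omega T v)%E.
Proof.
move=> u2 v2; apply: ge_ereal_sup => _ [phi [tphi phi1] <-].
rewrite box_distBl//; last exact: tphi.1.
apply: (@le_trans _ _
  (`|box_dist Omega T u phi|%:E + `|box_dist Omega T v phi|%:E)%E).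
  by rewrite -EFinD lee_fin ler_normB.
by apply: leeD; apply: ereal_sup_ubound; exists phi.
Qed.

Lemma box_norm_fin u : Hspace Omega T u -> box_norm Omega T u \is a fin_num.
Proof. by move=> [_ uoo]; rewrite ge0_fin_numE ?box_norm_ge0. Qed.

Lemma HspaceB u v : Hspace Omega T u -> Hspace Omega T v ->
  Hspace Omega T (u \- v).
Proof.
move=> [u2 uoo] [v2 voo]; split; first exact: L2B.
by apply: le_lt_trans (box_normB u2 v2) _; exact: lte_add_pinfty.
Qed.

Lemma Hnorm_triangle u v : Hspace Omega T u -> Hspace Omega T v ->
  Hnorm Omega T (u \- v) <= Hnorm Omega T u + Hnorm Omega T v.
Proof.
move=> Hu Hv; have [u2 _] := Hu; have [v2 _] := Hv.
apply: euclid_triangle; first exact: L2norm_ge0.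
- exact: L2norm_ge0.
- exact: L2norm_ge0.
- exact: fine_ge0 (box_norm_ge0 _).
- exact: fine_ge0 (box_norm_ge0 _).
- exact: fine_ge0 (box_norm_ge0 _).
- exact: L2norm_triangle.
rewrite -lee_fin EFinD !fineK ?box_norm_fin//; last exact: HspaceB.
exact: box_normB.
Qed.

Lemma XspaceB u v : Xspace Omega T u -> Xspace Omega T v ->
  Xspace Omega T (u \- v).
Proof.
move=> [Hu uX] [Hv vX]; split; first exact: HspaceB.
move=> e e0; have e20 : 0 < e / 2 by rewrite divr_gt0.
have [w [w11 Hw wu]] := uX _ e20; have [w' [w'11 Hw' w'v]] := vX _ e20.
exists (w \- w'); split; [|exact: HspaceB|].
  by apply: H11B => //; rewrite lexx ltW.
rewrite subfACA.
apply: le_lt_trans (Hnorm_triangle (HspaceB Hw Hu) (HspaceB Hw' Hv)) _.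
by rewrite [ltRHS]splitr; exact: ltrD.
Qed.

(** Homogeneity turns the bound on the unit ball into a bound by the norm.
    Rescaling by [e^-1] rather than by the inverse of the norm also covers test
    functions whose norm is zero. *)
Lemma box_dist_le u phi e : Hspace Omega T u -> testfun Qm phi -> 0 < e ->
  H1norm Qm phi <= e ->
  `|box_dist Omega T u phi| <= fine (box_norm Omega T u) * e.
Proof.
move=> Hu tphi e0 phie; rewrite -ler_pdivrMr// -lee_fin fineK ?box_norm_fin//.
apply: ereal_sup_ubound; exists (fun x => e^-1 * phi x) => /=.
  split; first exact: testfunZ.
  rewrite H1normZ//; last exact: tphi.1.
  by rewrite ger0_norm ?invr_ge0 ?(ltW e0)// -ler_pdivlMl ?invr_gt0// invrK mulr1.
rewrite box_distZr; [|exact: Hu.1|exact: tphi.1].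
by rewrite normrM (ger0_norm (_ : 0 <= e^-1)) ?invr_ge0 ?(ltW e0)// mulrC.
Qed.

Lemma box_dist_close u (phi phi' : nat -> 'rV[R]_(1 + n) -> R) psi g :
  Hspace Omega T u ->
  (forall k, testfun Qm (phi k)) -> H1cvg Qm phi psi g ->
  (forall k, testfun Qm (phi' k)) -> H1cvg Qm phi' psi g ->
  forall e, 0 < e -> exists N, forall k l, (N <= k)%N -> (N <= l)%N ->
    `|box_dist Omega T u (phi k) - box_dist Omega T u (phi' l)| < e.
Proof.
move=> Hu tphi phig tphi' phi'g e e0; set b := fine (box_norm Omega T u).
have b0 : 0 <= b by rewrite fine_ge0 ?box_norm_ge0.
have d0 : 0 < e / (b + 1) by rewrite divr_gt0// ltr_wpDl.
have [N phiN] := H1cvg_close bQm tphi phig tphi' phi'g d0.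
exists N => k l Nk Nl.
rewrite -box_distBr; [|exact: Hu.1|exact: (tphi k).1|exact: (tphi' l).1].
apply: (le_lt_trans (box_dist_le Hu (testfunB (tphi k) (tphi' l)) d0 _)).
  exact: phiN.
by rewrite -/b mulrA ltr_pdivrMr ?ltr_wpDl// mulrC ltr_pM2l// ltrDl.
Qed.

(** The functional [box_dist u] is bounded for the H^1 norm, hence extends by
    continuity. *)
Lemma box_pairing_cvg u (phi : nat -> 'rV[R]_(1 + n) -> R) psi :
  Hspace Omega T u -> (forall k, testfun Qm (phi k)) ->
  H1cvg Qm phi psi (fun i => wpartial Qm i psi) ->
  box_dist Omega T u (phi k) @[k --> \oo] --> box_pairing Omega T u psi.
Proof.
move=> Hu tphi phig.
have /cvg_ex[l phil] : cvg (box_dist Omega T u (phi k) @[k --> \oo]).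
  apply/cauchy_cvgP/cauchy_exP => e e0.
  have [N phiN] := box_dist_close Hu tphi phig tphi phig e0.
  exists (box_dist Omega T u (phi N)); exists N => // k Nk.
  exact: phiN.
rewrite /box_pairing (@xget_unique _ _ _ l)//; first by exists phi.
move=> l' [phi' [tphi' phi'g phi'l']].
have dcvg0 : box_dist Omega T u (phi k) - box_dist Omega T u (phi' k)
    @[k --> \oo] --> (0 : R).
  apply/cvgrPdist_lt => e e0.
  have [N phiN] := box_dist_close Hu tphi phig tphi' phi'g e0.
  by exists N => // k Nk; rewrite /= sub0r normrN; exact: phiN.
have ll' : 0 = l - l' := cvg_unique (@Rhausdorff R) dcvg0 (cvgB phil phi'l').
by apply/esym/eqP; rewrite -subr_eq0 -ll'.
Qed.

(** The sequences along which the pairing is computed do not depend on [u], so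
    that it is linear in [u]; when there are none, all the pairings with [psi]
    have the default value [0]. *)
Lemma box_pairingB u v psi : Hspace Omega T u -> Hspace Omega T v ->
  box_pairing Omega T (u \- v) psi =
  box_pairing Omega T u psi - box_pairing Omega T v psi.
Proof.
move=> Hu Hv.
have [[phi [tphi phig]]|nophi] := pselect (exists phi : nat -> _,
    (forall k, testfun Qm (phi k)) /\
    H1cvg Qm phi psi (fun i => wpartial Qm i psi)).
  have uphi := box_pairing_cvg Hu tphi phig.
  have vphi := box_pairing_cvg Hv tphi phig.
  have uvphi := box_pairing_cvg (HspaceB Hu Hv) tphi phig.
  have distB : (fun k => box_dist Omega T (u \- v) (phi k)) =
      (fun k => box_dist Omega T u (phi k) - box_dist Omega T v (phi k)).
    by apply/funext => k; rewrite box_distBl//;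
      [exact: Hu.1|exact: Hv.1|exact: (tphi k).1].
  rewrite distB in uvphi.
  have pairingB : box_pairing Omega T (u \- v) psi =
      box_pairing Omega T u psi - box_pairing Omega T v psi :=
    cvg_unique (@Rhausdorff R) uvphi (cvgB uphi vphi).
  exact: pairingB.
by rewrite /box_pairing !xgetPN ?subr0// => l [phi [tphi phig _]];
  apply: nophi; exists phi.
Qed.

Lemma BopB u v q : Hspace Omega T u -> Hspace Omega T v ->
  Bop Omega T (u \- v) q = Bop Omega T u q - Bop Omega T v q.
Proof. exact: box_pairingB. Qed.

End wave_spaces.

(** * The Schur complement *)

Section schur_complement.
Context {R : realType} {n : nat} {Omega : set 'rV[R]_n} {T : R}.
Hypotheses (bOmega : bounded_domain Omega) (T0 : 0 < T).
Variable S : ('rV[R]_(1 + n) -> R) -> ('rV[R]_(1 + n) -> R) -> R.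
Hypothesis schurS : is_schur Omega T S.
Local Notation X := (Xspace Omega T).

Lemma AopC w q : Aop Omega T w q = Aop Omega T q w.
Proof.
apply: (f_equal2 +%R); first exact: ipC.
by apply: eq_bigr => i _; exact: ipC.
Qed.

Lemma Aop_ge0 w : 0 <= Aop Omega T w w.
Proof. by rewrite /Aop addr_ge0 ?ip_ge0// sumr_ge0// => i _; exact: ip_ge0. Qed.

(** [A^-1 B u] lies in Y, so that the equation defining [A^-1 B v] may be tested
    with it: [<B v, A^-1 B u> = <A (A^-1 B v), A^-1 B u>]. *)
Lemma schur_Aop u v : X u -> X v ->
  exists wu wv, [/\ S u v = Aop Omega T wv wu, S v u = Aop Omega T wu wv,
    S u u = Aop Omega T wu wu & S v v = Aop Omega T wv wv].
Proof.
move=> Xu Xv; have [wu [[Ywu Awu] Su]] := schurS Xu.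
have [wv [[Ywv Awv] Sv]] := schurS Xv.
by exists wu, wv; split; rewrite ?Su ?Sv ?Awu ?Awv.
Qed.

Lemma schurC u v : X u -> X v -> S u v = S v u.
Proof. by move=> Xu Xv; have [wu [wv [-> -> _ _]]] := schur_Aop Xu Xv; exact: AopC. Qed.

Lemma schur_ge0 u : X u -> 0 <= S u u.
Proof. by move=> Xu; have [wu [_ [_ _ -> _]]] := schur_Aop Xu Xu; exact: Aop_ge0. Qed.

Lemma schurBr u v w : X u -> X v -> X w -> S u (v \- w) = S u v - S u w.
Proof.
move=> Xu Xv Xw; have [wu [_ Su]] := schurS Xu.
rewrite !Su//; last exact: XspaceB.
by apply: BopB => //; [exact: Xv.1|exact: Xw.1].
Qed.

Lemma schurBl u v w : X u -> X v -> X w -> S (u \- v) w = S u w - S v w.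
Proof.
move=> Xu Xv Xw; rewrite (schurC (XspaceB bOmega T0 Xu Xv) Xw) schurBr//.
by rewrite (schurC Xw Xu) (schurC Xw Xv).
Qed.

Lemma energy_identity rho ub u : L2 (Qcyl Omega T) ub -> X ub ->
  is_solution Omega T S rho ub u ->
  ip (Qcyl Omega T) (u \- ub) (u \- ub) + rho * S (u \- ub) (u \- ub) =
  - rho * S ub (u \- ub).
Proof.
move=> ub2 Xub [Xu solu]; have mQ := (cylinder_bounded_domain bOmega 0 T).1.
have Xd := XspaceB bOmega T0 Xu Xub; have u2 := Xu.1.1.
have d2 := Xd.1.1; have := solu _ Xd.
by rewrite (ipBl mQ u2 ub2 d2) (schurBl Xu Xub Xd) => E; lra.
Qed.

End schur_complement.

Theorem theorem3p2 (R : realType) (n : nat) (hn : (1 <= n <= 3)%N)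
    (Omega : set 'rV[R]_n) (hOmega : convex_domain Omega)
    (T : R) (hT : 0 < T)
    (S : ('rV[R]_(1 + n) -> R) -> ('rV[R]_(1 + n) -> R) -> R)
    (hS : is_schur Omega T S)
    (rho : R) (hrho : 0 < rho)
    (ub urho : 'rV[R]_(1 + n) -> R) (hub : L2 (Qcyl Omega T) ub)
    (hurho : is_solution Omega T S rho ub urho) :
  [/\ L2norm (Qcyl Omega T) (urho \- ub) <= L2norm (Qcyl Omega T) ub,
      Xspace Omega T ub ->
        L2norm (Qcyl Omega T) (urho \- ub) <= Num.sqrt rho * Snorm S ub /\
        Snorm S (urho \- ub) <= Snorm S ub
    & Xspace Omega T ub ->
        forall g, S_in_L2 Omega T S ub g ->
        L2norm (Qcyl Omega T) (urho \- ub) <= rho * L2norm (Qcyl Omega T) g /\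
        Snorm S (urho \- ub) <= Num.sqrt rho * L2norm (Qcyl Omega T) g].
Proof.
have bO : bounded_domain Omega.
  by case: hOmega => _ oO bdO _; exact: open_bounded_domain.
have mQ := (cylinder_bounded_domain bO 0 T).1.
have [Xu solu] := hurho; have u2 := Xu.1.1.
have r0 := ltW hrho.
set Q := Qcyl Omega T in u2 mQ hub solu *; set d := urho \- ub.
split=> [|Xub|Xub g [g2 Sub]].
- apply: ler_wsqrtr; rewrite ip_subself//.
  have := solu _ Xu; have := mulr_ge0 r0 (schur_ge0 hS Xu).
  have := ip_ge0 Q urho; rewrite (ipC Q ub).
  by set a := rho * _; set b := ip Q urho urho; set c := ip Q _ ub; lra.
- have Xd := XspaceB bO hT Xu Xub.
  have := energy_identity bO hT hS hub Xub hurho; rewrite -/Q -/d => energy.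
  have Sdd := mulr_ge0 r0 (schur_ge0 hS Xd).
  have ipdd := ip_ge0 Q d.
  (* Young's inequality for [- S ub d], as [urho = d + ub] *)
  have Suu : 0 <= S d d + 2 * S ub d + S ub ub.
    rewrite (_ : _ + _ = S urho urho); first exact: (schur_ge0 hS Xu).
    rewrite (schurBr bO hT hS Xub Xu Xub) (schurBl bO hT hS Xu Xub Xd).
    rewrite (schurBr bO hT hS Xu Xu Xub) (schurBr bO hT hS Xub Xu Xub).
    by rewrite (schurC hS Xub Xu); ring.
  have {}Suu := mulr_ge0 r0 Suu.
  split; first by rewrite /Snorm -sqrtrM//; apply: ler_wsqrtr; nra.
  by apply: ler_wsqrtr; rewrite -(ler_pM2l hrho); nra.
- have Xd := XspaceB bO hT Xu Xub.
  have d2 : L2 Q d := Xd.1.1.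
  have := energy_identity bO hT hS hub Xub hurho; rewrite -/Q -/d Sub// => energy.
  have Sdd := mulr_ge0 r0 (schur_ge0 hS Xd).
  have ipdd := ip_ge0 Q d.
  (* Young's inequality for [- rho * ip Q g d] *)
  have := ip_ge0 Q (d \- (fun x => - rho * g x)).
  have rg2 := L2Z (- rho) mQ g2.
  rewrite ip_subself// !ipZr// (ipC Q (fun x => - rho * g x)) ipZr// (ipC Q d).
  move=> young; split.
    rewrite -[rho in leRHS](ger0_norm r0) -sqrtr_sqr -sqrtrM ?sqr_ge0//.
    by apply: ler_wsqrtr; lra.
  rewrite -sqrtrM//; apply: ler_wsqrtr; rewrite -(ler_pM2l hrho).
  by have := mulr_ge0 (sqr_ge0 rho) (ip_ge0 Q g); lra.
Qed.
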